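(* Let $TM=\{n\ge1: t(n)=1\}$, where $t$ is the Thue–Morse sequence, and list $TM=(tm_n)_{n\ge1}$ in increasing order. Then $(tm_n)$ is uniformly behaved in $\mathbb N$; that is, for every real $0<\theta<1$, $$\lim_{N\to\infty}\frac1N\sum_{n=1}^N e^{2\pi i\,tm_n\theta}=0.$$
   Context: For a natural number $n$ let $s(n)$ be the number of $1$'s in the binary expansion of $n$. The Thue–Morse sequence is $t(n)=0$ if $s(n)$ is even and $t(n)=1$ if $s(n)$ is odd. *)

(* Defs.v *)
From HB Require Import structures.
From mathcomp Require Import all_boot all_order all_algebra.
From mathcomp Require Import all_classical all_reals all_analysis.
From mathcomp Require Import complex.
From mathcomp Require Import zify.

Set Implicit Arguments.
Unset Strict Implicit.
Unset Printing Implicit Defensive.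

Import Order.TTheory GRing.Theory Num.Theory.
Import numFieldNormedType.Exports.

(* The bit of weight 2 ^ i is [(n %/ 2 ^ i) %% 2]; it vanishes for n <= i,
   since n < 2 ^ n, so that the range i < n covers all the nonzero bits. *)
Definition binary_ones (n : nat) : nat := \sum_(i < n) (n %/ 2 ^ i) %% 2.

Definition thue_morse (n : nat) : nat := if odd (binary_ones n) then 1 else 0.

Definition TM : pred nat := [pred n | (1 <= n) && (thue_morse n == 1)].

Lemma binary_onesE n m : n <= m ->
  binary_ones n = \sum_(i < m) (n %/ 2 ^ i) %% 2.
Proof.
move=> le_nm; rewrite /binary_ones.
rewrite -(big_mkord predT (fun i => (n %/ 2 ^ i) %% 2)).
rewrite -(big_mkord predT (fun i => (n %/ 2 ^ i) %% 2)).
rewrite [RHS](big_cat_nat _ le_nm) //= [X in _ + X]big1_seq ?addn0 //= => i.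
rewrite mem_index_iota => /andP[le_ni _].
by rewrite divn_small // (leq_ltn_trans le_ni) // ltn_expl.
Qed.

Lemma binary_ones_double (b : bool) n :
  binary_ones (b + n.*2) = b + binary_ones n.
Proof.
rewrite (@binary_onesE _ (b + n.*2).+1) // big_ord_recl /= expn0 divn1.
congr (_ + _); first by lia.
rewrite (@binary_onesE n (b + n.*2)); last by lia.
apply: eq_bigr => i _; rewrite /bump /= add1n expnS divnMA.
by congr (_ %/ _ %% _); lia.
Qed.

Lemma TM_unbounded m : exists n, (m < n) && (n \in TM).
Proof.
exists (~~ odd (binary_ones m.+1) + m.+1.*2).
rewrite inE /thue_morse binary_ones_double oddD.
by case: (odd (binary_ones m.+1)) => /=; lia.
Qed.

(* [tm n], for n >= 1, is the n-th element of TM in increasing order. The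
   value [tm 0 = 0] is a sentinel below TM, not a term of the sequence. *)
Fixpoint tm (n : nat) : nat :=
  if n is n'.+1 then ex_minn (TM_unbounded (tm n')) else 0.

Lemma tm_increasing : {homo tm : m n / m < n}.
Proof.
apply: homo_ltn; first exact: ltn_trans.
by move=> n /=; case: ex_minnP => k /andP[].
Qed.

Lemma TM_tm k : reflect (exists2 n, 1 <= n & tm n = k) (k \in TM).
Proof.
apply: (iffP idP) => [kTM|[[//|n] _ <-] /=]; last first.
  by case: ex_minnP => m /andP[].
have ge_tm n : n <= tm n.
  by elim: n => // n IH; apply: leq_ltn_trans IH (tm_increasing (ltnSn n)).
have ex : exists n, k <= tm n by exists k.
case: (ex_minnP ex) => -[|n] le_k min_n.
  by move: kTM le_k; rewrite inE => /andP[/=]; lia.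
exists n.+1 => //; apply/eqP; rewrite eqn_leq le_k andbT.
have lt_k : tm n < k by rewrite ltnNge; apply/negP => /min_n; rewrite ltnn.
by rewrite /=; case: ex_minnP => m _; apply; rewrite lt_k.
Qed.

Local Open Scope ring_scope.
Local Open Scope complex_scope.
Local Open Scope classical_set_scope.

Definition cexp (R : realType) (z : R[i]) : R[i] :=
  (expR (complex.Re z))%:C * (cos (complex.Im z) +i* sin (complex.Im z)).

(* The ascription to [numFieldType] is what gives R[i] the topology of its
   norm. The term of index N = 0 is the junk value 0^-1 * 0 = 0. *)
Definition uniformly_behaved (R : realType) (a : nat -> nat) : Prop :=
  forall theta : R, 0 < theta < 1 ->
    (fun N : nat => N%:R^-1 *
        \sum_(1 <= n < N.+1) cexp (2 * pi%:C * 'i%C * (a n)%:R * theta%:C)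
      : (R[i] : numFieldType)) @ \oo --> (0 : (R[i] : numFieldType)).

(* Main.v *)
Require Import Defs.
From mathcomp Require Import all_boot all_order all_algebra.
From mathcomp Require Import all_reals.
From mathcomp Require Import all_classical all_analysis.
From mathcomp Require Import complex.
From mathcomp Require Import zify ring lra.

Set Implicit Arguments.
Unset Strict Implicit.
Unset Printing Implicit Defensive.

Import Order.TTheory GRing.Theory Num.Theory.
Import numFieldNormedType.Exports.

(** Write eps_m = (-1) ^ s(m). Since appending a binary digit to m adds that
    digit to s, exactly one of 2m and 2m+1 lies in TM, whence the closed form
    [tmS]: the element of TM of rank n+1 is 2n or 2n+1 according to the parity
    of s(n). For z = exp(2 i pi theta) this rewrites the exponential sum over
    the first N elements of TM ([sum_tm]) as half of

      (1 + z + ... + z ^ (2N-1)) + (z - 1) * S_N(z ^ 2),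
      where S_N(w) = eps_0 + eps_1 w + ... + eps_{N-1} w ^ (N-1).

    The geometric sum is bounded because z != 1, which is where 0 < theta < 1
    enters. It remains to see that S_N(w) = o(N) on the whole unit circle.
    Splitting indices by parity gives S_{2N}(w) = (1 - w) S_N(w ^ 2), hence
    S_{4N}(w) = (1 - w)(1 - w ^ 2) S_N(w ^ 4). A single factor may have modulus
    2, the trivial bound, but the product of two consecutive ones has modulus
    |1 - w| ^ 2 |1 + w| <= 7/2 < 4 ([norm_two_steps]). Each division of N by 4
    thus gains a factor 7/8 on the trivial bound |S_N| <= N, at the price of an
    additive constant: |S_N(w)| <= (7/8) ^ j N + D_j for every j
    ([tmsum_le]). Dividing by N and letting N, then j, grow gives the limit 0
    ([mean_cvg0]). *)

Lemma TM_double (b : bool) m :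
  (b + m.*2 \in TM) = b (+) odd (binary_ones m).
Proof.
rewrite inE /thue_morse binary_ones_double oddD oddb.
case: b => /=; case: (posnP m) => [->|m_gt0]; rewrite ?andbT //=.
- by rewrite /binary_ones big_ord0.
- by case: ifP.
- by rewrite /binary_ones big_ord0.
- by rewrite double_gt0 m_gt0; case: ifP.
Qed.

(** The right-hand side increases with n and, by [TM_double], takes exactly the
    values in TM; an increasing enumeration is unique. *)
Lemma tmS n : tm n.+1 = ~~ odd (binary_ones n) + n.*2.
Proof.
pose a m := ~~ odd (binary_ones m) + m.*2.
have a_lt m p : m < p -> a m < a p.
  by rewrite /a; do 2!case: odd => /=; lia.
have aTM m : a m \in TM by rewrite TM_double; case: odd.
have TMa k : k \in TM -> k = a k./2.
  rewrite -{1}(odd_double_half k) TM_double => odd_k.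
  rewrite -[LHS]odd_double_half /a; congr (_ + _)%N.
  by move: odd_k; do 2!case: odd.
rewrite -/(a n); elim: n => [|n IHn] /=; case: ex_minnP => k /andP[gt_k kTM] min_k.
  (* TM starts at a 0 = 1, just above the sentinel tm 0 = 0. *)
  apply/eqP; rewrite eqn_leq; apply/andP; split.
    by apply: min_k; rewrite aTM /a /binary_ones big_ord0.
  by move: gt_k; rewrite /a /binary_ones big_ord0.
apply/eqP; rewrite eqn_leq; apply/andP; split.
  by apply: min_k; rewrite -/(tm n.+1) IHn aTM a_lt.
move: gt_k; rewrite -/(tm n.+1) IHn (TMa k kTM) => lt_a.
have [le_k|] := leqP k./2 n; last by rewrite leq_eqVlt => /orP[/eqP<-|/a_lt/ltnW].
by move: lt_a; move: le_k; rewrite leq_eqVlt => /orP[/eqP->|/a_lt]; lia.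
Qed.

Local Open Scope ring_scope.

Section ThueMorseSums.
Variable C : numClosedFieldType.
Implicit Types (w z : C) (N M : nat).

Definition tmsum w N : C := \sum_(m < N) (-1) ^+ binary_ones m * w ^+ m.

(** Consecutive indices 2m and 2m+1 carry opposite signs, so they contribute
    (1 - w) w ^ (2m) up to the sign of index m. *)
Lemma tmsum_double w N : tmsum w N.*2 = (1 - w) * tmsum (w ^+ 2) N.
Proof.
elim: N => [|N IHN]; first by rewrite /tmsum !big_ord0 mulr0.
rewrite /tmsum doubleS !big_ord_recr /= -!/(tmsum _ _) IHN.
have := binary_ones_double false N; have := binary_ones_double true N.
rewrite add0n !add1n => -> ->; rewrite -exprM mul2n !exprS; ring.
Qed.

Lemma tmsum_addn w M r : `|w| = 1 -> `|tmsum w (M + r)| <= `|tmsum w M| + r%:R.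
Proof.
move=> w1; elim: r => [|r IHr]; first by rewrite addn0 addr0.
rewrite addnS /tmsum big_ord_recr -/(tmsum _ _) /=.
apply: le_trans (ler_normD _ _) _; rewrite normrM !normrX normrN1 w1 !expr1n mulr1.
by rewrite -natr1 addrA lerD2r.
Qed.

(** With a = |1 + w|, the parallelogram law turns the product into
    (4 - a ^ 2) a. Its maximum 16 / (3 sqrt 3), about 3.08, is reached at
    a = 2 / sqrt 3; any bound below 4 serves here, and 7/2 has a short
    certificate. *)
Lemma norm_two_steps w : `|w| = 1 -> `|1 - w| * `|1 - w ^+ 2| <= 7 / 2.
Proof.
move=> w1.
have -> : 1 - w ^+ 2 = (1 - w) * (1 + w) by ring.
have ww : w * w^* = 1 by rewrite -normCK w1 expr1n.
have par : `|1 - w| ^+ 2 = 4 - `|1 + w| ^+ 2.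
  rewrite !normCK !rmorphD rmorphN !rmorph1.
  have -> : (1 - w) * (1 - w^*) = 1 - w - w^* + w * w^* by ring.
  have -> : (1 + w) * (1 + w^*) = 1 + w + w^* + w * w^* by ring.
  rewrite ww; ring.
rewrite normrM mulrA -expr2 par.
move: `|1 + w| (normr_ge0 (1 + w)) => a a0.
(* Tangent line to a ^ 3 at 6/5, a rational point close to 2 / sqrt 3:
   a ^ 3 - 3 k ^ 2 a + 2 k ^ 3 = (a - k) ^ 2 (a + 2 k) with k = 6/5. *)
rewrite -subr_ge0.
have -> : 7 / 2 - (4 - a ^+ 2) * a =
   (a - 6 / 5) ^+ 2 * (a + 12 / 5) + (8 / 25) * a + 11 / 250 by field.
have sq0 : 0 <= (a - 6 / 5) ^+ 2.
  by rewrite real_exprn_even_ge0 // rpredB // ger0_real // divr_ge0 // ler0n.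
have pos p q : 0 <= p%:R / q%:R :> C by rewrite divr_ge0 ?ler0n.
apply: addr_ge0; last exact: pos.
apply: addr_ge0; apply: mulr_ge0 => //; first by apply: addr_ge0.
Qed.

(** The constant D depends on j only. Uniformity in w is essential, since the
    induction passes from w to w ^ 4. *)
Lemma tmsum_le j : exists D : C, forall w N, `|w| = 1 ->
  `|tmsum w N| <= (7 / 8) ^+ j * N%:R + D.
Proof.
elim: j => [|j [D IHj]].
  exists 0 => w N w1; rewrite mul1r addr0.
  have := tmsum_addn 0 N w1.
  by rewrite add0n {2}/tmsum big_ord0 normr0 add0r.
exists (7 / 2 * D + 3) => w N w1.
have w2 : `|w ^+ 2| = 1 by rewrite normrX w1 expr1n.
have w4 : `|(w ^+ 2) ^+ 2| = 1 by rewrite normrX w2 expr1n.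
set M := (N %/ 4)%N.
have eN : N = (M.*2.*2 + N %% 4)%N by rewrite /M; lia.
have q0 : 0 <= (7 / 8) ^+ j :> C by rewrite exprn_ge0 // divr_ge0 // ler0n.
have h0 : 0 <= 7 / 2 :> C by rewrite divr_ge0 // ler0n.
rewrite {1}eN; apply: le_trans (tmsum_addn _ _ w1) _.
rewrite addrA lerD //; last by rewrite ler_nat; lia.
rewrite !tmsum_double mulrA normrM normrM.
apply: le_trans (ler_pM _ _ (norm_two_steps w1) (IHj _ M w4)) _ => //.
rewrite mulrDr lerD2r exprS.
have -> : 7 / 2 * ((7 / 8) ^+ j * M%:R) = 7 / 8 * (7 / 8) ^+ j * (4 * M%:R) :> C.
  by field.
rewrite ler_wpM2l ?mulr_ge0 ?invr_ge0 ?ler0n // -natrM ler_nat /M; lia.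
Qed.

(** The factor of z ^ (2n) in the left-hand side is z if eps_n = 1 and 1 if
    eps_n = -1, which is ((1 + z) + eps_n (z - 1)) / 2; the part 1 + z
    assembles into the geometric sum. *)
Lemma sum_tm z N : \sum_(1 <= n < N.+1) z ^+ tm n =
  (\sum_(k < N.*2) z ^+ k + (z - 1) * tmsum (z ^+ 2) N) / 2.
Proof.
rewrite big_add1; under eq_bigr do rewrite tmS.
rewrite /= big_mkord.
elim: N => [|N IHN]; first by rewrite /tmsum !big_ord0 mulr0 addr0 mul0r.
rewrite doubleS /tmsum !big_ord_recr -/(tmsum _ _) /= IHN.
rewrite -signr_odd -exprM mul2n [z ^+ N.*2.+1]exprS exprD.
by case: odd => /=; field.
Qed.

Lemma sum_tm_le z j : `|z| = 1 -> z != 1 -> exists D : C, forall N,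
  `|\sum_(1 <= n < N.+1) z ^+ tm n| <= (7 / 8) ^+ j * N%:R + D.
Proof.
move=> z1 zn1; have [D leD] := tmsum_le j.
exists (D + `|z - 1|^-1) => N; rewrite sum_tm.
have d0 : 0 < `|z - 1| by rewrite normr_gt0 subr_eq0.
have geo : `|\sum_(k < N.*2) z ^+ k| <= 2 * `|z - 1|^-1.
  rewrite ler_pdivlMr // mulrC -normrM -subrX1.
  by apply: le_trans (ler_normB _ _) _; rewrite normrX z1 expr1n normr1.
have z2 : `|z ^+ 2| = 1 by rewrite normrX z1 expr1n.
rewrite normrM [`|2^-1|]ger0_norm ?invr_ge0 ?ler0n // ler_pdivrMr ?ltr0n //.
rewrite addrA [leRHS]mulrDl; apply: le_trans (ler_normD _ _) _.
rewrite [leRHS]addrC lerD //; first by rewrite [leRHS]mulrC.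
rewrite normrM [leLHS]mulrC; apply: ler_pM => //; first exact: leD.
by apply: le_trans (ler_normB _ _) _; rewrite z1 normr1.
Qed.

End ThueMorseSums.

Local Open Scope complex_scope.
Local Open Scope classical_set_scope.

Section Convergence.
Variable R : realType.

Lemma cexp_natM (x : R) k :
  cexp (2 * pi%:C * 'i%C * k%:R * x%:C) =
  (cos (2 * pi * x) +i* sin (2 * pi * x)) ^+ k.
Proof.
have -> : 2 * pi%:C * 'i%C * k%:R * x%:C = 0 +i* (k%:R * (2 * pi * x)) :> R[i].
  by rewrite -!(rmorph_nat (@real_complex R)); simpc; congr (_ +i* _); ring.
rewrite /cexp /= expR0 mul1r.
elim: k => [|k IHk]; first by rewrite mul0r cos0 sin0 expr0.
rewrite exprS -IHk -natr1 mulrDl mul1r addrC cosD sinD; simpc.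
by congr (_ +i* _); ring.
Qed.

Lemma norm_cos_sin (x : R) : `|cos x +i* sin x| = 1 :> R[i].
Proof. by rewrite normc_def /= cos2Dsin2 sqrtr1. Qed.

(** If cos (2 pi x) = 1 then sin (pi x) = 0, which fails for pi x in ]0, pi[. *)
Lemma cos_sin_neq1 (x : R) : 0 < x < 1 ->
  cos (2 * pi * x) +i* sin (2 * pi * x) != 1 :> R[i].
Proof.
move=> /andP[x0 x1]; apply/eqP => -[cos1 _].
have : 0 < sin (pi * x).
  by apply: sin_gt0_pi; rewrite ?mulr_gt0 ?pi_gt0 // gtr_pMr ?pi_gt0.
move: cos1; rewrite -mulrA mulrC mulr_natr cos_mulr2n => cos1.
have := cos2Dsin2 (pi * x); nra.
Qed.

(** For a given tolerance e, choose j so that (7/8) ^ j < e/2, then N beyond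
    2 D / e. Both choices are made in R: a positive element of R[i] has
    imaginary part 0. *)
Lemma mean_cvg0 (f : nat -> R[i]) :
  (forall j, exists D : R[i], forall N, `|f N| <= (7 / 8) ^+ j * N%:R + D) ->
  (fun N : nat => N%:R^-1 * f N : (R[i] : numFieldType)) @ \oo -->
    (0 : (R[i] : numFieldType)).
Proof.
move=> fle; apply/cvgr0Pnorm_lt => -[e i]; rewrite ltcE /= => /andP[/eqP-> e0].
have [j qj] : exists j, (7 / 8) ^+ j < e / 2.
  have q1 : `|7 / 8 : R| < 1 by rewrite ger0_norm; lra.
  have e2 : 0 < e / 2 by lra.
  have [j _ /(_ j (leqnn j))/=] := @cvgr0_norm_lt _ _ _ _ _ _ (cvg_expr q1) _ e2.
  by rewrite ger0_norm ?exprn_ge0; [exists j|lra|lra].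
have [[d i'] fD] := fle j.
(* At N = 0 the bound forces D itself to be real and nonnegative. *)
have := le_trans (normr_ge0 _) (fD 0%N).
rewrite mulr0 add0r lecE /= => /andP[/eqP i'0 d0].
near=> N.
have N0 : 0 < N%:R :> R by near: N; exact: nbhs_infty_gtr.
have Nd : 2 * d / e < N%:R by near: N; exact: nbhs_infty_gtr.
have N0C : 0 < N%:R :> R[i] by rewrite -(rmorph_nat (@real_complex R)) ltcR.
rewrite normrM ger0_norm ?invr_ge0 ?ltW // mulrC ltr_pdivrMr //.
apply: le_lt_trans (fD N) _.
have -> : (7 / 8) ^+ j * N%:R + (d +i* i') = ((7 / 8) ^+ j * N%:R + d)%:C.
  by rewrite i'0 !(rmorphD, rmorphM, rmorphXn, fmorphV, rmorph_nat).
have -> : (e +i* 0) * N%:R = (e * N%:R)%:C by rewrite rmorphM rmorph_nat.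
rewrite ltcR; move: Nd; rewrite ltr_pdivrMr // => Nd.
have : (7 / 8) ^+ j * N%:R < e / 2 * N%:R by rewrite ltr_pM2r.
lra.
Unshelve. all: by end_near.
Qed.
End Convergence.

Theorem corollary10 (R : realType) : uniformly_behaved R tm.
Proof.
move=> theta theta01; apply: mean_cvg0 => j.
have [D leD] := sum_tm_le j (norm_cos_sin (2 * pi * theta)) (cos_sin_neq1 theta01).
exists D => N; under eq_bigr do rewrite cexp_natM; exact: leD.
Qed.
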